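(* Let $N$ be a normal subgroup of a finite group $G$, let $\{n_1^G,\dots,n_k^G\}$ be the set of $G$-conjugacy classes of $N$, and let $\Delta=\{\chi_1=1_G,\chi_2,\dots,\chi_k\}$ be a representative system of the equivalence classes of the equivalence relation with respect to $N$ on $\mathrm{Irr}(G)$. For each $i$ let $\theta_i\in\mathrm{Irr}(N)$ be an irreducible constituent of $(\chi_i)_N$, $t_i=|G:I_G(\theta_i)|$, $e_i=[(\chi_i)_N,\theta_i]$ and $\lambda_i=|N|\,t_i\,e_i^2$. Let $\mathsf{X}=(\chi_i(n_j))_{1\le i,j\le k}$ be the $G$-character table of $N$ constructed from $\Delta$. Then, for $1\le i\le k$, $$e_i^2\,t_i=\frac{\lambda_i}{|N|},\qquad t_i\,\theta_i(1)^2=\frac{|N|\,\chi_i(1)^2}{\lambda_i},\qquad \frac{\theta_i(1)}{e_i}=\frac{|N|\,\chi_i(1)}{\lambda_i},$$ and the right-hand sides of these relations can be computed from the $G$-character table $\mathsf{X}$ of $N$ (that is, they depend only on the matrix $\mathsf{X}$).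
   Context: Characters are over $\mathbb{C}$; $\chi_N$ is the restriction of $\chi$ to $N$. The $G$-conjugacy classes of $N$ are the conjugacy classes of $G$ contained in $N$. $G$ acts on $\mathrm{Irr}(N)$ by $\theta^g(x)=\theta(gxg^{-1})$, and $I_G(\theta)=\{g\in G\mid\theta^g=\theta\}$. Two characters $\chi,\phi\in\mathrm{Irr}(G)$ are equivalent with respect to $N$ if $[\chi_N,\phi_N]\ne0$; this is an equivalence relation, and the number of its classes equals the number $k$ of $G$-conjugacy classes of $N$, so $\mathsf{X}$ is square. Its first row is the row of the trivial character $1_G$. *)

(* Defs.v *)
(* algC stands for the complex numbers, as everywhere in mathcomp.character. *)
From mathcomp Require Import all_boot all_order all_fingroup all_algebra.
From mathcomp Require Import all_solvable all_field all_character.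

Set Implicit Arguments.
Unset Strict Implicit.
Unset Printing Implicit Defensive.

Import GroupScope Order.TTheory GRing.Theory Num.Theory.
Local Open Scope ring_scope.

Section GCharacterTable.

Variables (gT : finGroupType) (G N : {group gT}).

Definition equivalent_wrt (r s : Iirr G) : bool :=
  '['Res[N] 'chi_r, 'Res[N] 'chi_s] != 0.

Variable k : nat.

Definition Gclass_representatives (n : 'I_k -> gT) : Prop :=
  injective (fun j => n j ^: G) /\
  [set n j ^: G | j : 'I_k] = [set C in classes G | C \subset N].

Definition representative_system (chi : 'I_k -> Iirr G) : Prop :=
  forall r : Iirr G, exists! i : 'I_k, equivalent_wrt r (chi i).

Definition Gcharacter_table (n : 'I_k -> gT) (chi : 'I_k -> Iirr G) :
    'M[algC]_k :=
  \matrix_(i, j) 'chi_(chi i) (n j).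

Definition ramification (r : Iirr G) (s : Iirr N) : algC :=
  '['Res[N] 'chi_r, 'chi_s].

Definition inertia_index (s : Iirr N) : nat := #|G : 'I_G['chi_s]|.

Definition lambda_ (r : Iirr G) (s : Iirr N) : algC :=
  #|N|%:R * (inertia_index s)%:R * ramification r s ^+ 2.

End GCharacterTable.

(* Main.v *)
(** The relation [chi_N = e * (sum of the orbit of theta)] given by Clifford
    gives [(chi_N, chi_N) = e^2 t] and [chi(1) = e t theta(1)], hence the three
    identities.  With the weights [c_j = |n_j^G| / |N|], the rows of [X] are
    orthogonal for the Hermitian form with diagonal matrix [c], the norm of
    row [i] being [e_i^2 t_i = lambda_i / |N|]; in particular [X] is invertible.
    Since row [0] is constant equal to 1, orthogonality with it determines [c]
    from [X] ([c *m X^T = delta_0 = 1 *m X^-1]), hence the [lambda_i / |N|], and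
    [chi_i(1)] is the largest modulus in row [i]. *)
Require Import Defs.
From mathcomp Require Import all_boot all_order all_fingroup all_algebra.
From mathcomp Require Import all_solvable all_field all_character.
From mathcomp Require Import ring.

Set Implicit Arguments.
Unset Strict Implicit.
Unset Printing Implicit Defensive.

Import GroupScope Order.TTheory GRing.Theory Num.Theory.
Local Open Scope ring_scope.

Section TableFunctions.

Variables (k : nat) (X : 'M[algC]_k).

(** Solves [c *m X^T = delta_0]. For arbitrary [k] there is no index 0 to name, so [delta_0] is
    written as [const_mx 1 *m invmx X]. *)
Definition table_weights : 'rV[algC]_k :=
  const_mx 1 *m invmx X *m invmx X^T.

Definition table_norm (i : 'I_k) : algC :=
  \sum_j table_weights 0 j * X i j * (X i j)^*.

(** The inequality in [algC] forces the picked entry to be real and nonnegative. The default 0 is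
    never reached on a character table, since the column of the identity qualifies. *)
Definition table_degree (i : 'I_k) : algC :=
  if [pick j | [forall l, `|X i l| <= X i j]] is Some j then X i j else 0.

Lemma table_degreeP (i j : 'I_k) :
  (forall l, `|X i l| <= X i j) -> table_degree i = X i j.
Proof.
move=> maxj; rewrite /table_degree; case: pickP => [j' /forallP maxj' | noj].
  apply/le_anti/andP; split.
    by rewrite (le_trans _ (maxj j')) // real_ler_norm // ger0_real
               ?(le_trans _ (maxj' j)).
  by rewrite (le_trans _ (maxj' j)) // real_ler_norm // ger0_real
             ?(le_trans _ (maxj j)).
by have /forallP[] := negbT (noj j).
Qed.

End TableFunctions.

Section Clifford.

Variables (gT : finGroupType) (G N : {group gT}).
Hypothesis nsNG : N <| G.

Variables (r : Iirr G) (s : Iirr N).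
Hypothesis rs : s \in irr_constt ('Res[N] 'chi_r).

Let e := ramification r s.
Let t : algC := (inertia_index G s)%:R.

Lemma sum_cfclass_const (F : 'CF(N) -> algC) (a : algC) :
    (forall y, y \in G -> F ('chi_s ^ y)%CF = a) ->
  \sum_(phi <- ('chi_s ^: G)%CF) F phi = t * a.
Proof.
move=> Fa; rewrite (eq_big_seq (fun=> a)) => [|_ /cfclassP[y Gy ->]]; last exact: Fa.
by rewrite big_const_seq count_predT iter_addr_0 size_cfclass mulr_natl.
Qed.

Lemma ramification_neq0 : e != 0.
Proof. by rewrite -irr_consttE. Qed.

Lemma inertia_index_neq0 : t != 0.
Proof. by rewrite pnatr_eq0 -lt0n indexg_gt0. Qed.

Lemma cfnorm_Res_irr : '['Res[N] 'chi_r] = e ^+ 2 * t.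
Proof.
(* Only the second argument is expanded: every conjugate of ['chi_s] has the same multiplicity [e]
   in the first. *)
rewrite {2}(Clifford_Res_sum_cfclass nsNG rs) cfdotZr cfdot_sumr.
rewrite (@sum_cfclass_const (cfdot _) e) => [|y Gy]; last exact: cfdot_Res_conjg.
rewrite -/e conj_natr ?Cnat_cfdot_char ?cfRes_char ?irr_char //.
by rewrite mulrCA mulrC expr2.
Qed.

Lemma irr1_Clifford : 'chi_r 1%g = e * t * 'chi_s 1%g.
Proof.
rewrite -(cfRes1 N) (Clifford_Res_sum_cfclass nsNG rs) cfunE sum_cfunE.
rewrite (@sum_cfclass_const (fun phi => phi 1%g) ('chi_s 1%g)) ?mulrA //.
by move=> y _; rewrite cfConjg1.
Qed.

End Clifford.

Section Table.

Variables (gT : finGroupType) (G N : {group gT}) (k : nat).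
Variables (n : 'I_k.+1 -> gT) (chi : 'I_k.+1 -> Iirr G).
Hypothesis nsNG : N <| G.
Hypothesis repn : Gclass_representatives G N n.
Hypothesis repchi : representative_system N chi.
Hypothesis chi0 : 'chi_(chi ord0) = 1.

Let X := Gcharacter_table n chi.
Let c j : algC := #|n j ^: G|%:R / #|N|%:R.

Lemma Gclass_repr_in j : n j \in N.
Proof.
have /setIdP[_ /subsetP sN] : n j ^: G \in [set C in classes G | C \subset N].
  by rewrite -repn.2; apply/imsetP; exists j.
by rewrite sN ?class_refl.
Qed.

Lemma sum_Gclasses (F : gT -> algC) :
    (forall x y, y \in G -> F (x ^ y)%g = F x) ->
  \sum_(x in N) F x = \sum_j #|n j ^: G|%:R * F (n j).
Proof.
move=> FJ; have /andP[sNG nNG] := nsNG.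
rewrite (partition_big (class^~ G) (mem [set n j ^: G | j : 'I_k.+1])) /=; last first.
  by move=> x Nx; rewrite repn.2 inE mem_classes ?(subsetP sNG) ?class_sub_norm.
rewrite big_imset /=; last by move=> ? ? _ _; apply: repn.1.
(* The fibre of the class map over [n j ^: G] is that class itself, which lies in [N] by
   normality. *)
apply: eq_bigr => j _; rewrite (eq_bigl (mem (n j ^: G))) => [|x /=]; last first.
  rewrite (sameP eqP class_eqP); apply: andb_idl => /imsetP[y Gy ->].
  by rewrite memJ_norm ?(subsetP nNG) ?Gclass_repr_in.
rewrite (eq_bigr (fun=> F (n j))) ?sumr_const ?mulr_natl //.
by move=> _ /imsetP[y Gy ->]; rewrite FJ.
Qed.

Lemma cfdot_Res_table (phi psi : 'CF(G)) :
  '['Res[N] phi, 'Res[N] psi] = \sum_j c j * phi (n j) * (psi (n j))^*.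
Proof.
have sNG := normal_sub nsNG.
rewrite cfdotE (eq_bigr (fun x => phi x * (psi x)^*)) => [|x Nx]; last first.
  by rewrite !cfResE.
rewrite sum_Gclasses => [|x y Gy]; last by rewrite !cfunJ.
by rewrite mulr_sumr; apply: eq_bigr => j _; rewrite !mulrA [_^-1 * _]mulrC.
Qed.

Lemma cfnorm_Res_irr_neq0 (r : Iirr G) : '['Res[N] 'chi_r] != 0.
Proof. by rewrite cfnorm_eq0 Res_irr_neq0. Qed.

(** If the product is nonzero, [i] and [l] both index a representative equivalent to [chi i], so
    uniqueness identifies them. *)
Lemma cfdot_Res_repr i l :
  '['Res[N] 'chi_(chi i), 'Res[N] 'chi_(chi l)]
    = '['Res[N] 'chi_(chi i)] *+ (i == l).
Proof.
case: eqVneq => [-> | neq_il] //=; rewrite mulr0n; apply: contra_neq_eq neq_il => eq_il.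
have [m [_ uniq_m]] := repchi (chi i).
by rewrite -(uniq_m i) ?(uniq_m l) //; apply: cfnorm_Res_irr_neq0.
Qed.

Lemma table_orthogonality i l :
  \sum_j c j * X i j * (X l j)^* = '['Res[N] 'chi_(chi i)] *+ (i == l).
Proof.
by rewrite -cfdot_Res_repr cfdot_Res_table; apply: eq_bigr => j _; rewrite !mxE.
Qed.

Lemma Gcharacter_table_unit : X \in unitmx.
Proof.
(* Orthogonality makes the weighted conjugate transpose, with columns divided by the norms, a right
   inverse. *)
pose B := \matrix_(j, l) (c j * (X l j)^* / '['Res[N] 'chi_(chi l)]).
suffices /mulmx1_unit[] : X *m B = 1%:M by [].
apply/matrixP=> i l; rewrite !mxE.
transitivity ((\sum_j c j * X i j * (X l j)^*) / '['Res[N] 'chi_(chi l)]).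
  rewrite mulr_suml; apply: eq_bigr => j _.
  rewrite [B j l]mxE; move: (c j) (X i j) => x y.
  by rewrite !mulrA [x * y]mulrC.
rewrite table_orthogonality; case: eqVneq => [-> | _]; last by rewrite mul0r.
by rewrite divff ?cfnorm_Res_irr_neq0.
Qed.

Lemma table_row0 j : X ord0 j = 1.
Proof.
by rewrite mxE chi0 cfun1E (subsetP (normal_sub nsNG)) ?Gclass_repr_in.
Qed.

Lemma table_weightsE j : table_weights X 0 j = c j.
Proof.
pose d : 'rV[algC]_k.+1 := delta_mx 0 ord0.
have -> : table_weights X = \row_j c j.
  have Xu := Gcharacter_table_unit.
  (* Orthogonality with row 0, whose norm is 1. *)
  have -> : \row_j c j = d *m invmx X^T.
    apply: canRL (mulmxK _) _; first by rewrite unitmx_tr.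
    apply/rowP=> l; rewrite !mxE eqxx /=.
    transitivity (\sum_j c j * X l j * (X ord0 j)^*).
      by apply: eq_bigr => j' _; rewrite table_row0 conjC1 mulr1 2!mxE.
    rewrite table_orthogonality; case: eqVneq => [-> | _] //.
    by rewrite chi0 cfRes_cfun1 ?normal_sub // cfnorm1.
  congr (_ *m _); apply: (canLR (mulmxK Xu)).
  by rewrite -rowE; apply/rowP=> l; rewrite mxE [RHS]mxE table_row0.
by rewrite mxE.
Qed.

Lemma table_normE i : table_norm X i = '['Res[N] 'chi_(chi i)].
Proof.
transitivity (\sum_j c j * X i j * (X i j)^*).
  by apply: eq_bigr => j _; rewrite table_weightsE.
by rewrite table_orthogonality eqxx.
Qed.

Lemma table_degreeE i : table_degree X i = 'chi_(chi i) 1%g.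
Proof.
(* The class of the identity is a singleton, so some [n j] equals 1; its column dominates since a
   character is bounded in modulus by its degree. *)
have: 1%g ^: G \in [set n j ^: G | j : 'I_k.+1].
  by rewrite repn.2 inE mem_classes // class1G sub1G.
case/imsetP=> j _; rewrite class1G => /esym/eqP; rewrite eqEsubset => /andP[+ _].
move/subsetP/(_ _ (class_refl _ _))/set1P=> nj1.
rewrite (@table_degreeP _ X i j) => [|l]; first by rewrite mxE nj1.
by rewrite !mxE nj1 char1_ge_norm ?irr_char.
Qed.

End Table.

Theorem corollary4p10 :
  exists F1 F2 F3 : forall k : nat, 'M[algC]_k -> 'I_k -> algC,
  forall (gT : finGroupType) (G N : {group gT}) (k : nat)
    (n : 'I_k.+1 -> gT) (chi : 'I_k.+1 -> Iirr G) (theta : 'I_k.+1 -> Iirr N),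
  N <| G ->
  Gclass_representatives G N n ->
  representative_system N chi ->
  'chi_(chi ord0) = 1 ->
  (forall i, theta i \in irr_constt ('Res[N] 'chi_(chi i))) ->
  forall i : 'I_k.+1,
  let X := Gcharacter_table n chi in
  let t := (inertia_index G (theta i))%:R : algC in
  let e := ramification (chi i) (theta i) in
  let lambda := lambda_ (chi i) (theta i) in
  [/\ e ^+ 2 * t = lambda / #|N|%:R,
      t * 'chi_(theta i) 1%g ^+ 2 = #|N|%:R * 'chi_(chi i) 1%g ^+ 2 / lambda
    & 'chi_(theta i) 1%g / e = #|N|%:R * 'chi_(chi i) 1%g / lambda]
  /\
  [/\ lambda / #|N|%:R = F1 k.+1 X i,
      #|N|%:R * 'chi_(chi i) 1%g ^+ 2 / lambda = F2 k.+1 X i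
    & #|N|%:R * 'chi_(chi i) 1%g / lambda = F3 k.+1 X i].
Proof.
(* As [table_norm] equals [lambda / #|N|], dividing by it supplies the factor [#|N| / lambda]. *)
exists table_norm, (fun k X i => table_degree X i ^+ 2 / table_norm X i),
  (fun k X i => table_degree X i / table_norm X i).
move=> gT G N k n chi theta nsNG repn repchi chi0 constt_theta i X t e lambda.
have rs := constt_theta i.
have N0 : #|N|%:R != 0 :> algC by rewrite neq0CG.
have e0 : e != 0 by apply: ramification_neq0 rs.
have t0 : t != 0 by apply: inertia_index_neq0.
rewrite (table_normE nsNG repn repchi chi0) (table_degreeE chi repn) (cfnorm_Res_irr nsNG rs).
(* All six identities now become rational identities in [#|N|], [e], [t] and the degree of
   [theta i]. *)
rewrite (irr1_Clifford nsNG rs) -/e -/t.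
have -> : lambda = #|N|%:R * t * e ^+ 2 by [].
by split; split; field; rewrite ?N0 ?e0 ?t0.
Qed.
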